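(* Let $S_M\in\{0,1\}$ be a baseline variable, $M(0),M(1)\in\{0,1\}$ the potential values of a binary mediator under exposure levels $0,1$, $Y(a,m)$ ($a,m\in\{0,1\}$) the controlled potential outcomes, and $Y(a)=Y(a,M(a))$. Suppose necessity, $P(M(b)=1\mid S_M=0,X)=0$ for each $b\in\{0,1\}$, and sufficiency-under-control, $P(M(0)=1\mid S_M=1,X)=1$. Then for each $a\in\{0,1\}$, $$\mathbb{E}[Y(a,M(0))]=\mathbb{E}[Y(a,1)\mid S_M=1]\,P(S_M=1)+\mathbb{E}[Y(a,0)\mid S_M=0]\,P(S_M=0).$$ Moreover, setting $$\Delta^{\text{dir-c}}_1=\mathbb{E}[Y(1,1)-Y(0,1)\mid S_M=1],\quad \Delta^{\text{dir-c}}_0=\mathbb{E}[Y(1,0)-Y(0,0)\mid S_M=0],\quad \Delta^{\text{indir-c}}_1=\mathbb{E}[Y(1)-Y(1,1)\mid S_M=1],$$ the pure natural direct effect, total natural indirect effect and total effect satisfy $$\mathbb{E}[Y(1,M(0))-Y(0,M(0))]=\Delta^{\text{dir-c}}_1P(S_M=1)+\Delta^{\text{dir-c}}_0P(S_M=0),$$ $$\mathbb{E}[Y(1,M(1))-Y(1,M(0))]=\Delta^{\text{indir-c}}_1P(S_M=1),$$ $$\mathbb{E}[Y(1)-Y(0)]=(\Delta^{\text{dir-c}}_1+\Delta^{\text{indir-c}}_1)P(S_M=1)+\Delta^{\text{dir-c}}_0P(S_M=0),$$ with $\Delta^{\text{dir-c}}_1+\Delta^{\text{indir-c}}_1=\mathbb{E}[Y(1)-Y(0)\mid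 S_M=1]$ and $\Delta^{\text{dir-c}}_0=\mathbb{E}[Y(1)-Y(0)\mid S_M=0]$.
   Context: All variables, including baseline covariates $X$, are defined on one probability space. $Y(a,M(a'))$ denotes $Y(a,m)$ evaluated at the random value $m=M(a')$. Conditional statements given $S_M=s$ and $X$ hold almost surely wherever the conditioning event has positive conditional probability. All displayed expectations are assumed finite, and the identities involving conditioning on $S_M=s$ are for $P(S_M=s)>0$, a product with $P(S_M=s)=0$ being read as $0$. *)

(* Defs.v *)
From HB Require Import structures.
From mathcomp Require Import all_boot all_order all_algebra.
From mathcomp Require Import all_classical all_reals all_analysis.

Set Implicit Arguments.
Unset Strict Implicit.
Unset Printing Implicit Defensive.

Import Order.TTheory GRing.Theory Num.Theory.
Import numFieldNormedType.Exports.

Local Open Scope classical_set_scope.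
Local Open Scope ring_scope.
Local Open Scope ereal_scope.

(* [g] is a version of [z |-> P(E | Z = z)], i.e. [g \o Z] is a version of the
   conditional probability of [E] given the sigma-algebra generated by [Z]. *)
Definition is_cond_prob d d' (T : measurableType d) (T' : measurableType d')
    (R : realType) (P : probability T R) (Z : T -> T') (E : set T)
    (g : T' -> R) : Prop :=
  [/\ measurable_fun [set: T'] g,
      P.-integrable [set: T] (fun w => (g (Z w))%:E) &
      forall B : set T', measurable B ->
        \int[P]_(w in Z @^-1` B) (g (Z w))%:E = P (E `&` (Z @^-1` B))].

(* "P(E | S = s, X) = c", almost surely wherever P(S = s | X) > 0.  Here
   [g (s, x)] is P(E | S = s, X = x) and [p x] is P(S = s | X = x).  Versions
   exist (Radon-Nikodym) and are a.s. unique, so the condition does not depend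
   on which ones are taken. *)
Definition cond_prob_eq d d' (T : measurableType d) (T' : measurableType d')
    (R : realType) (P : probability T R) (S : T -> bool) (X : T -> T')
    (E : set T) (s : bool) (c : R) : Prop :=
  exists (g : bool * T' -> R) (p : T' -> R),
    [/\ is_cond_prob P (fun w => (S w, X w)) E g,
        is_cond_prob P X (S @^-1` [set s]) p &
        {ae P, forall w, (0 < p (X w))%R -> g (s, X w) = c}].

(* E[Z | A] for an event [A]; since 0^-1 = 0, it is 0 when P(A) = 0, so that
   E[Z | A] * P A is then 0. *)
Definition cond_expectation d (T : measurableType d) (R : realType)
    (P : probability T R) (Z : T -> R) (A : set T) : \bar R :=
  ((fine (P A))^-1)%:E * \int[P]_(w in A) (Z w)%:E.

Definition finite_expectation d (T : measurableType d) (R : realType)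
    (P : probability T R) (Z : T -> R) : Prop :=
  P.-integrable [set: T] (fun w => (Z w)%:E).

(* E[|Z| | A] < +oo; no constraint when P(A) = 0. *)
Definition finite_cond_expectation d (T : measurableType d) (R : realType)
    (P : probability T R) (Z : T -> R) (A : set T) : Prop :=
  P.-integrable A (fun w => (Z w)%:E).

(* Exposure levels, mediator values and values of S_M, all in {0,1}, are
   encoded as booleans (0 = false, 1 = true). *)

(* Y(a, M(a')) *)
Definition nested_outcome (T : Type) (R : realType) (Y : bool -> bool -> T -> R)
    (M : bool -> T -> bool) (a a' : bool) : T -> R :=
  fun w => Y a (M a' w) w.

(* Y(a) = Y(a, M(a)) *)
Definition total_outcome (T : Type) (R : realType) (Y : bool -> bool -> T -> R)
    (M : bool -> T -> bool) (a : bool) : T -> R :=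
  nested_outcome Y M a a.

(* Main.v *)
Require Import Defs.
From HB Require Import structures.
From mathcomp Require Import all_boot all_order all_algebra.
From mathcomp Require Import all_classical all_reals all_analysis.

Set Implicit Arguments.
Unset Strict Implicit.
Unset Printing Implicit Defensive.

Import Order.TTheory GRing.Theory Num.Theory.
Import numFieldNormedType.Exports.

Local Open Scope classical_set_scope.
Local Open Scope ring_scope.
Local Open Scope ereal_scope.

(** Conditionally on [S = s] and [X], the two assumptions say that [M b] is a.s.
    constant; integrating out [X] gives [M b = 0] a.s. on [S = 0] and [M 0 = 1]
    a.s. on [S = 1].  Hence [Y a (M 0)] is a.s. [Y a 1] on [S = 1] and [Y a 0]
    on [S = 0], every total outcome is a.s. [Y a 0] on [S = 0], and all the
    identities follow by splitting expectations along [S]. *)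

Lemma measurable_fiber d (T : measurableType d) (S : {mfun T >-> bool})
    (s : bool) : measurable [set w | S w = s].
Proof. exact: (measurable_funPTI S (Y := [set s])). Qed.

(* Integrating [p] over [p <= 0] bounds [P (A `&` [p <= 0])] above by 0. *)
Lemma cond_prob_gt0_ae d d' (T : measurableType d) (T' : measurableType d')
    (R : realType) (P : probability T R) (X : {mfun T >-> T'}) (A : set T)
    (p : T' -> R) :
  measurable A -> is_cond_prob P X A p ->
  {ae P, forall w, A w -> (0 < p (X w))%R}.
Proof.
move=> mA [mp ip pE].
pose B := p @^-1` `]-oo, 0%R]%classic.
have mB : measurable B by rewrite -[B]setTI; exact: mp.
have mXB : measurable (X @^-1` B) by exact: measurable_funPTI.
have AB0 : P (A `&` X @^-1` B) = 0.
  apply/eqP; rewrite eq_le measure_ge0 andbT -pE//.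
  have -> : 0 = \int[P]_(w in X @^-1` B) (cst 0 w : \bar R).
    by rewrite integral0.
  apply: le_integral => //.
  - exact: integrableS ip.
  - exact: integrable0.
  - by move=> w; rewrite inE /B /= in_itv /= lee_fin.
exists (A `&` X @^-1` B); split => //; first exact: measurableI.
move=> w /= /not_implyP[Aw /negP]; rewrite -leNgt => pw.
by split => //; rewrite /B /= in_itv.
Qed.

(** Integrating out [X]: the event [S = s] is the preimage under [(S, X)] of a cylinder, so the
    defining property of [g] applies to it. By [cond_prob_gt0_ae], [p (X w)] is a.s. positive on
    that event, so [g] is a.s. equal to [c] there. *)
Lemma cond_prob_eq_joint d d' (T : measurableType d) (T' : measurableType d')
    (R : realType) (P : probability T R) (S : {mfun T >-> bool})
    (X : {mfun T >-> T'}) (E : set T) (s : bool) (c : R) :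
  cond_prob_eq P S X E s c ->
  P (E `&` [set w | S w = s]) = c%:E * P [set w | S w = s].
Proof.
move=> [g [p [[mg ig gE] hp gc]]].
have mS := measurable_fiber S s.
have pos := cond_prob_gt0_ae mS hp.
have SE : [set w | S w = s] =
    (fun w => (S w, X w)) @^-1` ([set s] `*` [set: T']).
  by apply/seteqP; split => w /= => [->|[]].
(* Both sides become integrals over the event [S = s], one of [g (S w, X w)] and one of the constant
   [c]. *)
rewrite -(integral_cst P mS c%:E) {1}SE -gE; last exact: measurableX.
rewrite -SE; apply: ae_eq_integral => //.
- by apply: measurable_int; apply: integrableS ig.
- apply: (filterS2 _ _ pos gc) => w pw gw Sw.
  by rewrite Sw gw //; apply: pw.
Qed.

Lemma cond_prob_eq0_ae d d' (T : measurableType d) (T' : measurableType d')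
    (R : realType) (P : probability T R) (S : {mfun T >-> bool})
    (X : {mfun T >-> T'}) (E : set T) (s : bool) :
  measurable E -> cond_prob_eq P S X E s 0%R ->
  {ae P, forall w, S w = s -> ~ E w}.
Proof.
move=> mE /cond_prob_eq_joint; rewrite mul0e => E0.
have mS := measurable_fiber S s.
exists (E `&` [set w | S w = s]); split => //; first exact: measurableI.
by move=> w /= /not_implyP[Sw /contrapT].
Qed.

Lemma cond_prob_eq1_ae d d' (T : measurableType d) (T' : measurableType d')
    (R : realType) (P : probability T R) (S : {mfun T >-> bool})
    (X : {mfun T >-> T'}) (E : set T) (s : bool) :
  measurable E -> cond_prob_eq P S X E s 1%R ->
  {ae P, forall w, S w = s -> E w}.
Proof.
move=> mE /cond_prob_eq_joint; rewrite mul1e => E1.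
have mS := measurable_fiber S s.
(* The exceptional set is null because [E] already carries all the mass of [S = s]; finiteness of
   [P] makes the subtraction in the extended reals legitimate. *)
exists ([set w | S w = s] `\` E); split => //.
- exact: measurableD.
- rewrite measureD//; last by rewrite ltey_eq fin_num_measure.
  by rewrite (setIC _ E) [X in _ - X]E1 subee// fin_num_measure.
- by move=> w /= /not_implyP.
Qed.

Section cond_expectation_theory.
Context d (T : measurableType d) (R : realType) (P : probability T R).
Variable A : set T.
Hypothesis mA : measurable A.

Lemma cond_expectationM (Z : T -> R) :
  finite_cond_expectation P Z A ->
  cond_expectation P Z A * P A = \int[P]_(w in A) (Z w)%:E.
Proof.
move=> iZ; have PA := fin_num_measure P _ mA.
(* On a null event both sides vanish, so the default value of [cond_expectation] is harmless.
   Otherwise the factor [P A] cancels its inverse. *)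
have [A0|A0] := eqVneq (P A) 0.
  by rewrite A0 mule0 null_set_integral//; exact: measurable_int iZ.
rewrite /cond_expectation -{2}(fineK PA) muleAC -EFinM mulVf ?mul1e//.
by rewrite fine_eq0.
Qed.

Lemma ae_eq_cond_expectation (Z Z' : T -> R) :
  finite_cond_expectation P Z A -> finite_cond_expectation P Z' A ->
  {ae P, forall w, A w -> Z w = Z' w} ->
  cond_expectation P Z A = cond_expectation P Z' A.
Proof.
move=> iZ iZ' ZZ'; congr (_ * _); apply: ae_eq_integral => //.
- exact: measurable_int iZ.
- exact: measurable_int iZ'.
- by apply: (filterS _ ZZ') => w h Aw; rewrite h.
Qed.

Lemma cond_expectationD (Z Z' : T -> R) :
  finite_cond_expectation P Z A -> finite_cond_expectation P Z' A ->
  cond_expectation P (Z \+ Z')%R A =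
  cond_expectation P Z A + cond_expectation P Z' A.
Proof.
move=> iZ iZ'; rewrite /cond_expectation -muleDr//; last first.
  (* Distributivity in the extended reals requires the sum of the two integrals to be defined;
     integrability makes them finite. *)
  by apply: fin_num_adde_defr; exact: integrable_fin_num.
by rewrite -integralD//.
Qed.

End cond_expectation_theory.

(** Law of total expectation along [S], with [Z] replaced on each stratum by an a.s. equal variable.
    Each expectation identity of the theorem is an instance, for a suitable choice of [Z1] and
    [Z0]. *)
Lemma expectation_stratify d (T : measurableType d) (R : realType)
    (P : probability T R) (S : {mfun T >-> bool}) (Z Z1 Z0 : T -> R) :
  let S1 := [set w | S w = true] in
  let S0 := [set w | S w = false] in
  finite_expectation P Z ->
  finite_cond_expectation P Z1 S1 -> finite_cond_expectation P Z0 S0 ->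
  {ae P, forall w, S w = true -> Z w = Z1 w} ->
  {ae P, forall w, S w = false -> Z w = Z0 w} ->
  'E_P[Z] = cond_expectation P Z1 S1 * P S1 + cond_expectation P Z0 S0 * P S0.
Proof.
move=> S1 S0 iZ i1 i0 e1 e0.
have m1 : measurable S1 := measurable_fiber S true.
have m0 : measurable S0 := measurable_fiber S false.
have iZS A : measurable A -> finite_cond_expectation P Z A.
  by move=> mA; apply: integrableS iZ.
rewrite -(ae_eq_cond_expectation m1 (iZS _ m1) i1 e1).
rewrite -(ae_eq_cond_expectation m0 (iZS _ m0) i0 e0).
rewrite !cond_expectationM//; try exact: iZS.
have ST : S1 `|` S0 = [set: T].
  apply/seteqP; split => // w _ /=; rewrite /S1 /S0 /=.
  by case: (S w); [left|right].
rewrite unlock -ST integral_setU//.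
- by rewrite ST; exact: measurable_int iZ.
- by apply/disj_setPS => w [S1w S0w]; move: (etrans (esym S1w) S0w).
Qed.

Theorem mainTheorem3 (d dX : measure_display) (T : measurableType d)
    (TX : measurableType dX) (R : realType) (P : probability T R)
    (X : {mfun T >-> TX}) (S : {mfun T >-> bool})
    (M : bool -> {mfun T >-> bool}) (Y : bool -> bool -> {RV P >-> R})
    (necessity : forall b : bool,
      cond_prob_eq P S X [set w | M b w = true] false 0%R)
    (sufficiency_under_control :
      cond_prob_eq P S X [set w | M false w = true] true 1%R) :
  let YM := nested_outcome (fun a m => Y a m : T -> R)
                           (fun b => M b : T -> bool) in
  let Yt := total_outcome (fun a m => Y a m : T -> R)
                          (fun b => M b : T -> bool) in
  let S1 := [set w | S w = true] in
  let S0 := [set w | S w = false] in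
  (forall a : bool, finite_expectation P (YM a false)) ->
  (forall a : bool, finite_cond_expectation P (Y a true) S1) ->
  (forall a : bool, finite_cond_expectation P (Y a false) S0) ->
  finite_cond_expectation P (Y true true \- Y false true)%R S1 ->
  finite_cond_expectation P (Y true false \- Y false false)%R S0 ->
  finite_cond_expectation P (Yt true \- Y true true)%R S1 ->
  finite_expectation P (YM true false \- YM false false)%R ->
  finite_expectation P (YM true true \- YM true false)%R ->
  finite_expectation P (Yt true \- Yt false)%R ->
  finite_cond_expectation P (Yt true \- Yt false)%R S1 ->
  finite_cond_expectation P (Yt true \- Yt false)%R S0 ->
  let Ddir1 := cond_expectation P (Y true true \- Y false true)%R S1 in
  let Ddir0 := cond_expectation P (Y true false \- Y false false)%R S0 in
  let Dindir1 := cond_expectation P (Yt true \- Y true true)%R S1 in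
  (forall a : bool,
     'E_P[YM a false] = cond_expectation P (Y a true) S1 * P S1
                      + cond_expectation P (Y a false) S0 * P S0) /\
  'E_P[YM true false \- YM false false] = Ddir1 * P S1 + Ddir0 * P S0 /\
  'E_P[YM true true \- YM true false] = Dindir1 * P S1 /\
  'E_P[Yt true \- Yt false] = (Ddir1 + Dindir1) * P S1 + Ddir0 * P S0 /\
  (0 < P S1 ->
     Ddir1 + Dindir1 = cond_expectation P (Yt true \- Yt false)%R S1) /\
  (0 < P S0 -> Ddir0 = cond_expectation P (Yt true \- Yt false)%R S0).
Proof.
move=> YM Yt S1 S0 iYM iY1 iY0 iD1 iD0 iI1 iNDE iNIE iTE iT1 iT0.
move=> Ddir1 Ddir0 Dindir1.
have m1 : measurable S1 := measurable_fiber S true.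
have m0 : measurable S0 := measurable_fiber S false.
have mM b : measurable [set w | M b w = true] := measurable_fiber (M b) true.
have M1 : {ae P, forall w, S w = true -> M false w = true}.
  exact: cond_prob_eq1_ae sufficiency_under_control.
have M0 b : {ae P, forall w, S w = false -> M b w = false}.
  apply: (filterS _ (cond_prob_eq0_ae (mM b) (necessity b))) => w h /h /=.
  by case: (M b w).
(* The two stratum identities come first, since the total effect is also deduced from them. *)
have D1E : Ddir1 + Dindir1 = cond_expectation P (Yt true \- Yt false)%R S1.
  (* In this order the sum telescopes to [Yt true - Y false true]. On [S1] the control mediator
     [M false] is a.s. 1, so [Y false true] is [Yt false] there. *)
  rewrite addeC -cond_expectationD//.
  apply: ae_eq_cond_expectation => //; first exact: (integrableD m1 iI1 iD1).
  apply: (filterS _ M1) => w h /h Mw /=.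
  by rewrite /Yt /total_outcome /nested_outcome Mw addrA subrK.
have D0E : Ddir0 = cond_expectation P (Yt true \- Yt false)%R S0.
  apply: ae_eq_cond_expectation => //.
  (* On [S0] both mediators are a.s. 0, so each total outcome [Yt a] is [Y a false]. *)
  apply: (filterS2 _ _ (M0 true) (M0 false)) => w ht hf Sw /=.
  by rewrite /Yt /total_outcome /nested_outcome ht ?hf.
split=> [a|]; last split; last split; last split.
- apply: (expectation_stratify (iYM a) (iY1 a) (iY0 a)).
  + by apply: (filterS _ M1) => w h /h Mw; rewrite /YM /nested_outcome Mw.
  + apply: (filterS _ (M0 false)) => w h /h Mw.
    by rewrite /YM /nested_outcome Mw.
- apply: (expectation_stratify iNDE iD1 iD0).
  + by apply: (filterS _ M1) => w h /h Mw; rewrite /YM /nested_outcome/= Mw.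
  + apply: (filterS _ (M0 false)) => w h /h Mw.
    by rewrite /YM /nested_outcome/= Mw.
(* Exposure cannot move the mediator on [S0], so the indirect contrast is a.s. zero there and only
   the [S1] term survives. *)
- rewrite (expectation_stratify (Z0 := cst 0%R) iNIE iI1)//.
  + by rewrite /cond_expectation integral0 mule0 mul0e adde0.
  + exact: integrable0.
  + apply: (filterS _ M1) => w h /h Mw.
    by rewrite /YM /Yt /total_outcome /nested_outcome/= Mw.
  + apply: (filterS2 _ _ (M0 true) (M0 false)) => w ht hf Sw.
    by rewrite /YM /nested_outcome/= ht ?hf ?subrr.
(* The total contrast serves as its own representative on both strata. *)
- by rewrite D1E D0E; apply: (expectation_stratify iTE iT1 iT0); exact: aeW.
- by split.
Qed.
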